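(* Let $p(x)$ be a real-rooted polynomial of degree $n$. If $\widetilde{p'}(x)$ is the rescaling of the derivative $p'(x)$ satisfying $\mathrm{Var}(\widetilde{p'})=\mathrm{Var}(p)$, then $$\Phi_{n-1}\big(\widetilde{p'}\big)\le \Phi_n(p).$$
   Context: For a real-rooted polynomial $p$ of degree $n$ with roots $\alpha_1,\dots,\alpha_n$ (with multiplicity), put $m_k(p)=\frac1n\sum_{i=1}^n\alpha_i^k$ and $\mathrm{Var}(p)=m_2(p)-m_1(p)^2$. The finite free Fisher information of $p$ is $$\Phi_n(p)=\frac1n\sum_{i=1}^n\Big(\frac{2}{n-1}\sum_{j\ne i}\frac{1}{\alpha_i-\alpha_j}\Big)^2,$$ which depends only on the roots of $p$. For $c\neq 0$ and a polynomial $q$ of degree $d$, $c_*q$ denotes the polynomial $(c_*q)(x)=c^{d}\,q(x/c)$, whose roots are $c$ times the roots of $q$; a rescaling of $p'$ is a polynomial of the form $c_*p'$. *)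

(* Defs.v *)
From mathcomp Require Import all_boot all_order all_algebra.
From mathcomp Require Import polyrcf.
From mathcomp Require Import reals constructive_ereal.

Set Implicit Arguments.
Unset Strict Implicit.
Unset Printing Implicit Defensive.

Import Order.TTheory GRing.Theory Num.Theory.
Local Open Scope ring_scope.

Definition degree (R : realType) (p : {poly R}) : nat := (size p).-1.

Definition real_rooted (R : realType) (p : {poly R}) : Prop :=
  exists s : seq R, p = lead_coef p *: \prod_(x <- s) ('X - x%:P).

(* The real roots of p in increasing order, each repeated according to its
   multiplicity ([rootsR] lists every root once; [rootsR 0 = [::]]). *)
Definition root_seq (R : realType) (p : {poly R}) : seq R :=
  flatten [seq nseq (mup x p) x | x <- rootsR p].

Lemma root_seqE (R : realType) (p : {poly R}) :
  p != 0 -> real_rooted p ->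
  p = lead_coef p *: \prod_(x <- root_seq p) ('X - x%:P).
Proof.
move=> p0 [s ps]; have lc0 : lead_coef p != 0 by rewrite lead_coef_eq0.
have mupE x : mup x p = count_mem x s.
  by rewrite -mu_prod_XsubC ps -mul_polyC mupMr // rootC.
suff rs : perm_eq (root_seq p) s by rewrite (perm_big _ rs).
apply/allP => x _ /=; apply/eqP; rewrite -mupE /root_seq count_flatten -map_comp.
rewrite (eq_map (_ : _ =1 fun y => ((y == x) * mup y p)%N)); last first.
  by move=> y /=; rewrite count_nseq.
have ur : uniq (rootsR p).
  exact: sorted_uniq lt_trans lt_irreflexive _ (sorted_roots _ _ _).
rewrite sumnE big_map; have [xr|xr] := boolP (x \in rootsR p).
  rewrite (bigD1_seq x) //= eqxx mul1n big1 ?addn0 // => y /negPf ->.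
  by rewrite mul0n.
rewrite big1_seq ?mupNroot //.
  by move: xr; rewrite -roots_on_rootsR // in_itv.
move=> y /andP[_ yr]; case: eqP => [yx|_]; last by rewrite mul0n.
by rewrite yx (negPf xr) in yr.
Qed.

Definition moment (R : realType) (k : nat) (p : {poly R}) : R :=
  (degree p)%:R^-1 * \sum_(x <- root_seq p) x ^+ k.

Definition variance (R : realType) (p : {poly R}) : R :=
  moment 2 p - moment 1 p ^+ 2.

(* Extended-real valued: when p has a repeated root, some difference of roots in
   the formula vanishes and the value is +oo. *)
Definition fisher_info (R : realType) (n : nat) (p : {poly R}) : \bar R :=
  let a := root_seq p in
  if uniq a then
    (n%:R^-1 * \sum_(i < n)
       (2 / (n%:R - 1) * \sum_(j < n | j != i) (a`_i - a`_j)^-1) ^+ 2)%:E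
  else +oo%E.

(* (c_* q)(x) = c ^ (deg q) * q (x / c) *)
Definition rescale (R : realType) (c : R) (q : {poly R}) : {poly R} :=
  c ^+ degree q *: (q \Po (c^-1 *: 'X)).

(* Main.v *)
(** Let a_1, ..., a_n be the roots of p and b_1, ..., b_(n-1) those of p'; we may
    assume the a_i distinct.  Put A_ji = 1/(b_j - a_i) and N_j = sum_i A_ji^2.
    The vectors A_j / sqrt N_j are orthonormal and orthogonal to (1, ..., 1), so
    they diagonalise the compression of diag(a) to the hyperplane of vectors of
    sum zero, and the eigenvalues are the b_j.  For a vector v, write v_jk for
    the entries of the compression of diag(v) in this basis; its squared
    Frobenius norm is (1 - 2/n) sum v_i^2 + (sum v_i)^2 / n^2.

    The score S_i = sum_(k <> i) 1/(a_i - a_k) of p and the score T_j of p'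
    satisfy T_j = S_jj: both equal - (sum_i A_ji^3) / N_j.  As sum S_i = 0,
    dropping the off-diagonal entries gives sum T_j^2 <= (1 - 2/n) sum S_i^2.
    For v = a the matrix is diagonal, hence Var p' = (n-2)/(n-1) Var p and
    c^2 = (n-1)/(n-2) (for n = 2 the hypothesis on c would force Var p = 0),
    which turns the bound on the scores into the claim. *)

Require Import Defs.
From mathcomp Require Import all_boot all_order all_algebra.
From mathcomp Require Import polyorder polyrcf.
From mathcomp Require Import reals constructive_ereal.
From mathcomp Require Import ring lra.

Set Implicit Arguments.
Unset Strict Implicit.
Unset Printing Implicit Defensive.

Import Order.TTheory GRing.Theory Num.Theory.
Local Open Scope ring_scope.

(** * Linear algebra of orthogonal rows of sum zero *)

Lemma sum_orthogonal_rows (F : fieldType) (m : nat) (A : 'I_m -> 'I_m.+1 -> F)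
    (n0 : m.+1%:R != 0 :> F)
    (A1 : forall j, \sum_i A j i = 0)
    (AA : forall j k, j != k -> \sum_i A j i * A k i = 0)
    (N0 : forall j, \sum_i A j i ^+ 2 != 0) (i l : 'I_m.+1) :
  \sum_j A j i * A j l / \sum_h A j h ^+ 2 = (i == l)%:R - m.+1%:R^-1.
Proof.
(* An extra row of ones makes the matrix square, so its right inverse is also a
   left inverse. *)
pose f (j h : 'I_m.+1) := if unlift ord0 j is Some k then A k h else 1.
pose g (j : 'I_m.+1) := \sum_h f j h ^+ 2.
have f0 h : f ord0 h = 1 by rewrite /f unlift_none.
have fS k h : f (lift ord0 k) h = A k h by rewrite /f liftK.
have g0 : g ord0 = m.+1%:R.
  rewrite /g (eq_bigr (fun=> 1)) => [|h _]; last by rewrite f0 expr1n.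
  by rewrite sumr_const card_ord.
have gS k : g (lift ord0 k) = \sum_h A k h ^+ 2.
  by apply: eq_bigr => h _; rewrite fS.
pose B := \matrix_(j, h) f j h; pose C := \matrix_(h, j) (f j h / g j).
have BC : B *m C = 1%:M.
  apply/matrixP => j k; rewrite !mxE.
  rewrite (eq_bigr (fun h => f j h * f k h / g k)) => [|h _]; last first.
    by rewrite !mxE mulrA.
  rewrite -mulr_suml.
  case: (unliftP ord0 j) => [j'|] ->; case: (unliftP ord0 k) => [k'|] ->.
  - rewrite (inj_eq (@lift_inj _ ord0)) gS.
    under eq_bigr => h _ do rewrite !fS.
    have [->|jk] := eqVneq j' k'; last by rewrite AA ?mul0r.
    under eq_bigr => h _ do rewrite -expr2.
    by rewrite divff.
  - under eq_bigr => h _ do rewrite fS f0 mulr1.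
    by rewrite A1 mul0r eq_sym (negPf (neq_lift _ _)).
  - under eq_bigr => h _ do rewrite fS f0 mul1r.
    by rewrite A1 mul0r (negPf (neq_lift _ _)).
  - rewrite eqxx (eq_bigr (fun=> 1)) => [|h _]; last by rewrite f0 mulr1.
    by rewrite sumr_const card_ord g0 divff.
have /matrixP/(_ i l) := mulmx1C BC; rewrite !mxE big_ord_recl !mxE f0 g0.
move=> <-; rewrite f0 mulr1 mul1r addrAC subrr add0r.
by apply: eq_bigr => k _; rewrite !mxE !fS gS mulrAC.
Qed.

(** Once the squares are expanded, the sum over [j] and [k] factors into [G i l ^+ 2], where [G] is
    the projection along the constant vectors onto those of sum zero. Dividing by squared norms
    avoids square roots. *)
Lemma frobenius_orthogonal_rows (F : fieldType) (m : nat)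
    (A : 'I_m -> 'I_m.+1 -> F)
    (n0 : m.+1%:R != 0 :> F)
    (A1 : forall j, \sum_i A j i = 0)
    (AA : forall j k, j != k -> \sum_i A j i * A k i = 0)
    (N0 : forall j, \sum_i A j i ^+ 2 != 0) (v : 'I_m.+1 -> F) :
  \sum_j \sum_k (\sum_i A j i * A k i * v i) ^+ 2 /
     ((\sum_i A j i ^+ 2) * (\sum_i A k i ^+ 2)) =
  (1 - 2 / m.+1%:R) * (\sum_i v i ^+ 2) + (\sum_i v i) ^+ 2 / m.+1%:R ^+ 2.
Proof.
set N := fun j => \sum_i A j i ^+ 2.
pose G i l := \sum_j A j i * A j l / N j.
transitivity (\sum_i \sum_l v i * v l * G i l ^+ 2).
  transitivity (\sum_j \sum_k \sum_i \sum_l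
    v i * v l * ((A j i * A j l / N j) * (A k i * A k l / N k))).
    apply: eq_bigr => j _; apply: eq_bigr => k _.
    rewrite expr2 mulr_suml mulr_suml; apply: eq_bigr => i _.
    rewrite mulr_sumr mulr_suml; apply: eq_bigr => l _.
    by rewrite invfM /N; ring.
  under eq_bigr => j _ do rewrite exchange_big /=.
  rewrite exchange_big /=; apply: eq_bigr => i _.
  under eq_bigr => j _ do rewrite exchange_big /=.
  rewrite exchange_big /=; apply: eq_bigr => l _.
  rewrite expr2 /G mulr_suml mulr_sumr; apply: eq_bigr => j _.
  by rewrite mulr_sumr mulr_sumr; apply: eq_bigr => k _.
transitivity (\sum_i (v i ^+ 2 * (1 - 2 / m.+1%:R)
                     + v i * (\sum_l v l) / m.+1%:R ^+ 2)).
  apply: eq_bigr => i _.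
  transitivity (\sum_l (v i * v l * (1 - 2 / m.+1%:R) * (i == l)%:R
                      + v i * v l / m.+1%:R ^+ 2)).
    apply: eq_bigr => l _; rewrite /G sum_orthogonal_rows //.
    by case: (i == l); rewrite /= -?exprVn; move: (m.+1%:R^-1) => z; ring.
  rewrite big_split /= (bigD1 i) //= eqxx big1 ?addr0 ?mulr1 => [|l].
    by rewrite -expr2; congr (_ + _); rewrite mulr_sumr mulr_suml.
  by rewrite eq_sym => /negPf ->; rewrite mulr0.
by rewrite big_split /= -!mulr_suml mulrC expr2.
Qed.

(** * Derivatives of split polynomials, and scores *)

(** These are iterated logarithmic derivatives: p' = p r1, with r1' = - r2 and r2' = - 2 r3. The
    third order serves to compute the score of p' at its own roots. *)
Lemma deriv_prod_XsubC (F : fieldType) (s : seq F) (x : F) :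
  x \notin s ->
  let p := \prod_(y <- s) ('X - y%:P) in
  let r1 := \sum_(y <- s) (x - y)^-1 in
  let r2 := \sum_(y <- s) (x - y)^-1 ^+ 2 in
  let r3 := \sum_(y <- s) (x - y)^-1 ^+ 3 in
  [/\ p^`().[x] = p.[x] * r1, p^`()^`().[x] = p.[x] * (r1 ^+ 2 - r2)
   & p^`()^`()^`().[x] = p.[x] * (r1 ^+ 3 - 3 * r1 * r2 + 2 * r3)].
Proof.
elim: s => [|y s IHs].
  by rewrite /= !big_nil -polyC1 !derivC !hornerC; split; ring.
rewrite inE negb_or /= => /andP[xy /IHs[]]; rewrite !big_cons.
set p := \prod_(_ <- s) _ => p1 p2 p3.
have xy0 : x - y != 0 by rewrite subr_eq0.
have dM q : (('X - y%:P) * q)^`() = q + ('X - y%:P) * q^`().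
  by rewrite derivM derivXsubC mul1r.
have d2 q :
    (('X - y%:P) * q)^`()^`() = 2 *: q^`() + ('X - y%:P) * q^`()^`().
  by rewrite dM derivD dM scaler_nat addrA.
have d3 q :
    (('X - y%:P) * q)^`()^`()^`()
    = 3 *: q^`()^`() + ('X - y%:P) * q^`()^`()^`().
  by rewrite d2 derivD derivZ dM addrA !scaler_nat -mulrSr.
rewrite d3 d2 dM !hornerE p1 p2 p3.
by split; field.
Qed.

Lemma sum_antisymmetric (F : numFieldType) (s : seq F) (g : F -> F -> F) :
  (forall x y, g y x = - g x y) ->
  \sum_(x <- s) \sum_(y <- s | y != x) g x y = 0.
Proof.
move=> gN; set S := LHS; have SN : S = - S.
  rewrite -sumrN {1}/S (exchange_big_dep xpredT) //=.
  apply: eq_bigr => x _; rewrite -sumrN; apply: eq_big => y; last by rewrite gN.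
  by rewrite eq_sym.
have /eqP: S *+ 2 = 0 by rewrite mulr2n {2}SN subrr.
by rewrite mulrn_eq0 => /eqP.
Qed.

(** For [x] in a duplicate-free [s], and outside characteristic 2, this is P''(x) / (2 P'(x)), where
    P is the monic polynomial with roots [s]. The guard compares values, which for such [s] agrees
    with the condition on indices in [fisher_info]. *)
Definition score (F : fieldType) (s : seq F) (x : F) : F :=
  \sum_(y <- s | y != x) (x - y)^-1.

Lemma sum_score (F : numFieldType) (s : seq F) : \sum_(x <- s) score s x = 0.
Proof. by apply: sum_antisymmetric => x y; rewrite -invrN opprB. Qed.

Lemma sum_sqr_score (F : numFieldType) (s : seq F) (b : F) :
  uniq s -> b \notin s -> \sum_(x <- s) (b - x)^-1 = 0 ->
  \sum_(x <- s) (b - x)^-1 ^+ 2 * score s x = - \sum_(x <- s) (b - x)^-1 ^+ 3.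
Proof.
move=> us bs r0; have bx x : x \in s -> b - x != 0.
  by move=> xs; rewrite subr_eq0; apply: contraNneq bs => ->.
(* [A_x^2 / (x - y) = A_x^2 A_y + A_x A_y / (x - y)], with [A_x = 1 / (b - x)] *)
transitivity (\sum_(x <- s) \sum_(y <- s | y != x)
    ((b - x)^-1 ^+ 2 * (b - y)^-1 + (b - x)^-1 * (b - y)^-1 / (x - y))).
  rewrite big_seq [RHS]big_seq; apply: eq_bigr => x xs; rewrite mulr_sumr.
  rewrite big_seq_cond [RHS]big_seq_cond; apply: eq_bigr => y /andP[ys yx].
  have xy : x - y != 0 by rewrite subr_eq0 eq_sym.
  have xyE : x - y = (b - y) - (b - x) by ring.
  rewrite xyE in xy *; move: (bx _ xs) (bx _ ys) xy; move: (b - x) (b - y).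
  by move=> u w u0 w0 uw; field; rewrite uw w0 u0.
(* The second term is antisymmetric in x and y, so it cancels. In the first, the A_y with y <> x add
   up to - A_x, because the full sum vanishes. *)
under eq_bigr => x _ do rewrite big_split /= -mulr_sumr.
rewrite big_split /= [X in _ + X]sum_antisymmetric ?addr0; last first.
  by move=> x y; rewrite -[y - x]opprB invrN mulrN [(b - y)^-1 * _]mulrC.
rewrite -sumrN big_seq [RHS]big_seq; apply: eq_bigr => x xs.
rewrite (bigD1_seq x) //= in r0.
by rewrite -[X in _ * X](addKr (b - x)^-1) r0 addr0 mulrN -exprSr.
Qed.

(** Factor p = (X - x) q: then p'(x) = q(x) and p''(x) = 2 q'(x), while q'(x) / q(x) is the
    score. *)
Lemma deriv_prod_XsubC_root (F : fieldType) (s : seq F) (x : F) :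
  uniq s -> x \in s ->
  let p := \prod_(y <- s) ('X - y%:P) in
  p^`().[x] != 0 /\ p^`()^`().[x] = 2 * p^`().[x] * score s x.
Proof.
move=> us xs; have -> : score s x = \sum_(y <- rem x s) (x - y)^-1.
  by rewrite rem_filter // big_filter.
rewrite (big_rem x) //=; set q := \prod_(_ <- _) _.
have xr : x \notin rem x s by rewrite mem_rem_uniqF.
have [q1 _ _] := deriv_prod_XsubC xr.
have dM r : (('X - x%:P) * r)^`() = r + ('X - x%:P) * r^`().
  by rewrite derivM derivXsubC mul1r.
have hx (u w : {poly F}) : (u + ('X - x%:P) * w).[x] = u.[x].
  by rewrite hornerD hornerM hornerXsubC subrr mul0r addr0.
rewrite dM hx derivD dM addrA hx hornerD q1; split; last by rewrite -/q; ring.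
by rewrite -rootE root_prod_XsubC.
Qed.

(** As p'(b) = 0, the derivative formulas reduce to p''(b) = - p(b) r2 and p'''(b) = 2 p(b) r3.
    Since p' = k q, also p'''(b) = 2 p''(b) [score t b]; comparing gives the last identity. That [b]
    is a simple root of q gives r2 <> 0. *)
Lemma critical_points (F : realFieldType) (s t : seq F) (k b : F) :
  uniq s -> uniq t -> k != 0 ->
  (\prod_(x <- s) ('X - x%:P))^`() = k *: \prod_(y <- t) ('X - y%:P) ->
  b \in t ->
  [/\ b \notin s, \sum_(x <- s) (b - x)^-1 = 0,
      \sum_(x <- s) (b - x)^-1 ^+ 2 != 0 &
      (\sum_(x <- s) (b - x)^-1 ^+ 2) * score t b
        = - \sum_(x <- s) (b - x)^-1 ^+ 3].
Proof.
set p := \prod_(_ <- _) _; set q := \prod_(_ <- _) _ => us ut k0 pq bt.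
have p'b0 : p^`().[b] = 0.
  by apply/eqP; rewrite pq hornerZ mulf_eq0 (negPf k0) -rootE root_prod_XsubC.
have bs : b \notin s.
  by apply/negP => bs; have [] := deriv_prod_XsubC_root us bs; rewrite p'b0 eqxx.
have [q'b0 q''b] := deriv_prod_XsubC_root ut bt.
have pb0 : p.[b] != 0 by rewrite -rootE root_prod_XsubC.
have [] := deriv_prod_XsubC bs; rewrite -/p p'b0 pq !derivZ !hornerZ q''b -/q.
set r1 := \sum_(x <- s) (b - x)^-1.
move=> /esym/eqP; rewrite mulf_eq0 (negPf pb0) => /eqP r10.
rewrite r10 !expr0n /= !(mulr0, mul0r, sub0r, subr0, add0r) => r2 r3.
have r20 : \sum_(x <- s) (b - x)^-1 ^+ 2 != 0.
  apply: contraNneq q'b0 => r20; apply/eqP/(mulfI k0).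
  by rewrite r2 r20 oppr0 !mulr0.
split=> //; apply: (mulfI pb0); apply: (mulfI (_ : 2 != 0 :> F)).
  by rewrite pnatr_eq0.
transitivity (- (2 * score t b * (k * q^`().[b]))); first by rewrite r2; ring.
transitivity (- (k * (2 * q^`().[b] * score t b))); first by ring.
by rewrite r3; ring.
Qed.

(** By partial fractions, (b' - b) / ((b - x) (b' - x)) = 1 / (b - x) - 1 / (b' - x). *)
Lemma critical_points_orthogonal (F : fieldType) (s : seq F) (b b' : F) :
  b \notin s -> b' \notin s -> b != b' ->
  \sum_(x <- s) (b - x)^-1 = 0 -> \sum_(x <- s) (b' - x)^-1 = 0 ->
  \sum_(x <- s) (b - x)^-1 * (b' - x)^-1 = 0.
Proof.
move=> bs b's bb' rb rb'; apply: (mulfI (_ : b' - b != 0)).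
  by rewrite subr_eq0 eq_sym.
transitivity (\sum_(x <- s) (b - x)^-1 - \sum_(x <- s) (b' - x)^-1); last first.
  by rewrite rb rb' subrr mulr0.
rewrite -sumrB mulr_sumr big_seq [RHS]big_seq.
apply: eq_bigr => x xs.
have bx : b - x != 0 by rewrite subr_eq0; apply: contraNneq bs => ->.
have b'x : b' - x != 0 by rewrite subr_eq0; apply: contraNneq b's => ->.
by field; rewrite bx b'x.
Qed.

(** * Roots of the derivative as eigenvalues of a compression *)

Section CriticalPoints.

Variables (F : realFieldType) (m : nat).
Variables (s : m.+1.-tuple F) (t : m.-tuple F) (k : F).
Hypotheses (us : uniq s) (ut : uniq t) (k0 : k != 0).
Hypothesis st :
  (\prod_(x <- s) ('X - x%:P))^`() = k *: \prod_(y <- t) ('X - y%:P).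

Let A (j : 'I_m) (i : 'I_m.+1) : F := (tnth t j - tnth s i)^-1.
Let N (j : 'I_m) : F := \sum_i A j i ^+ 2.

Let crit j := critical_points us ut k0 st (mem_tnth j t).

Let A1 j : \sum_i A j i = 0.
Proof. by have [_ +  _ _] := crit j; rewrite big_tuple. Qed.

Let N0 j : N j != 0.
Proof. by have [_ _ + _] := crit j; rewrite big_tuple. Qed.

Let AA j l : j != l -> \sum_i A j i * A l i = 0.
Proof.
move=> jl; have [js j1 _ _] := crit j; have [ls l1 _ _] := crit l.
have := critical_points_orthogonal js ls _ j1 l1; rewrite big_tuple; apply.
by rewrite (inj_eq (tuple_uniqP _ ut)).
Qed.

Let n0 : m.+1%:R != 0 :> F. Proof. by rewrite pnatr_eq0. Qed.

Let A0 j i : tnth t j - tnth s i != 0.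
Proof.
have [+ _ _ _] := crit j; rewrite subr_eq0.
by apply: contraNneq => ->; apply: mem_tnth.
Qed.

(** This is a trace. Summing A_ji^2 (b_j - a_i) = A_ji over i shows that b_j is the mean of the a_i
    with weights A_ji^2 / N_j; for fixed i these weights add up to 1 - 1/n. *)
Lemma sum_critical_points :
  \sum_(y <- t) y = (1 - m.+1%:R^-1) * \sum_(x <- s) x.
Proof.
rewrite !big_tuple mulr_sumr.
transitivity (\sum_j \sum_i A j i * A j i / N j * tnth s i).
  apply: eq_bigr => j _; apply: (mulfI (N0 j)).
  transitivity (\sum_i (A j i ^+ 2 * tnth t j - A j i)).
    by rewrite sumrB -mulr_suml A1 subr0.
  rewrite mulr_sumr; apply: eq_bigr => i _.
  move: (N0 j) (A0 j i); rewrite /A; move: (N j) (tnth t j) (tnth s i).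
  by move=> w y x w0 yx; field; rewrite w0 yx.
rewrite exchange_big; apply: eq_bigr => i _.
by rewrite -mulr_suml sum_orthogonal_rows // eqxx.
Qed.

Lemma sum_sqr_critical_points :
  \sum_(y <- t) y ^+ 2 = (1 - 2 / m.+1%:R) * (\sum_(x <- s) x ^+ 2)
                         + (\sum_(x <- s) x) ^+ 2 / m.+1%:R ^+ 2.
Proof.
rewrite !big_tuple -(frobenius_orthogonal_rows n0 A1 AA N0).
apply: eq_bigr => j _; rewrite (bigD1 j) //= [X in _ + X]big1 ?addr0 => [|l lj].
  rewrite (_ : \sum_i _ = N j * tnth t j).
    by rewrite -/(N j); move: (N0 j) => w0; field.
  transitivity (\sum_i (A j i ^+ 2 * tnth t j - A j i)).
    apply: eq_bigr => i _; move: (A0 j i); rewrite /A.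
    by move: (tnth t j) (tnth s i) => y x yx; field.
  by rewrite sumrB -mulr_suml A1 subr0.
(* Off the diagonal, A_ji A_li (b_j - a_i) = A_li; summed over i, orthogonality and the zero row sum
   make the entry vanish. *)
rewrite (_ : \sum_i _ = 0) ?expr0n ?mul0r //.
transitivity (\sum_i (A j i * A l i * tnth t j - A l i)).
  apply: eq_bigr => i _; move: (A0 j i) (A0 l i); rewrite /A.
  move: (tnth t j) (tnth t l) (tnth s i) => y z x yx zx.
  by field; rewrite yx zx.
by rewrite sumrB -mulr_suml A1 AA ?mul0r ?subrr // eq_sym.
Qed.

Lemma sum_sqr_score_critical_points :
  \sum_(y <- t) score t y ^+ 2
    <= (1 - 2 / m.+1%:R) * \sum_(x <- s) score s x ^+ 2.
Proof.
have := frobenius_orthogonal_rows n0 A1 AA N0 (fun i => score s (tnth s i)).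
rewrite -(big_tuple _ _ s xpredT (score s)) sum_score expr0n mul0r addr0.
rewrite -(big_tuple _ _ s xpredT (fun x => score s x ^+ 2)) => <-.
rewrite big_tuple; apply: ler_sum => j _; rewrite (bigD1 j) //= -/(N j).
have -> : score t (tnth t j) ^+ 2
    = (\sum_i A j i * A j i * score s (tnth s i)) ^+ 2 / (N j * N j).
  have [js j1 _ jT] := crit j; rewrite [X in X * _]big_tuple -/(N j) in jT.
  have := sum_sqr_score us js j1; rewrite -jT big_tuple.
  by move=> ->; move: (N0 j) => w0; field.
(* Only the nonnegative off-diagonal terms are discarded here. *)
rewrite lerDl; apply: sumr_ge0 => l _.
by rewrite divr_ge0 ?sqr_ge0 // mulr_ge0 ?sumr_ge0 // => i _; rewrite sqr_ge0.
Qed.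

End CriticalPoints.

(** * Real critical points by Rolle's theorem *)

Lemma derivative_roots (F : rcfType) (p : {poly F}) (s : seq F) :
  uniq s -> all (root p) s ->
  exists t, [/\ size t = (size s).-1, uniq t & all (root p^`()) t].
Proof.
move=> us ps; have ss : sorted <%R (sort <=%R s) by rewrite sort_lt_sorted.
have {ps} : all (root p) (sort <=%R s) by rewrite all_sort.
rewrite -(size_sort <=%R s); case: (sort _ _) ss => [_ _|x r /= xr /andP[px pr]].
  by exists [::].
(* Keeping [t] increasing and above [x] lets the induction prepend a Rolle point [z] between [x] and
   [y]. *)
suff [t [ts tx tr]] : exists t,
    [/\ size t = size r, path <%R x t & all (root p^`()) t].
  exists t; split=> //.
  by apply: sorted_uniq (path_sorted tx); [exact: lt_trans|exact: ltxx].
elim: r x xr px pr => [|y r IHr] x /=; first by exists [::].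
move=> /andP[xy yr] px /andP[py pr].
have [t [ts yt tr]] := IHr y yr py pr.
have [z] := poly_rolle xy (etrans (rootP px) (esym (rootP py))).
rewrite in_itv /= => /andP[xz zy] pz.
exists (z :: t); split; rewrite /= ?ts ?tr ?xz ?rootE ?pz ?eqxx //=.
by case: t yt {ts tr} => //= w t /andP[yw ->]; rewrite (lt_trans zy yw).
Qed.

(** * Scaling, and the defined quantities in terms of a list of roots *)

Lemma score_scale (F : fieldType) (s : seq F) (c x : F) :
  c != 0 -> score [seq c * y | y <- s] (c * x) = c^-1 * score s x.
Proof.
move=> c0; rewrite /score big_map mulr_sumr.
apply: eq_big => y; first by rewrite (inj_eq (mulfI c0)).
by rewrite -mulrBr invfM.
Qed.

Section RootSeq.

Variables (R : realType) (k : R) (s : seq R).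
Hypothesis k0 : k != 0.
Let p := k *: \prod_(x <- s) ('X - x%:P).

Lemma perm_root_seq : perm_eq (root_seq p) s.
Proof.
have kp : lead_coef p = k by rewrite lead_coefZ lead_coef_prod_XsubC mulr1.
have pr : real_rooted p by exists s; rewrite kp.
have p0 : p != 0 by rewrite -lead_coef_eq0 kp.
apply: prod_XsubC_eq; apply: (scalerI k0).
by rewrite -[RHS]/p [RHS](root_seqE p0 pr) kp.
Qed.

Lemma size_scale_prod_XsubC : size p = (size s).+1.
Proof. by rewrite size_scale // size_prod_XsubC. Qed.

Lemma varianceE :
  variance p = (size s)%:R^-1 * (\sum_(x <- s) x ^+ 2)
               - ((size s)%:R^-1 * \sum_(x <- s) x) ^+ 2.
Proof.
rewrite /variance /moment /degree size_scale_prod_XsubC /=.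
by rewrite !(perm_big _ perm_root_seq).
Qed.

Lemma fisher_infoE :
  uniq s ->
  fisher_info (size s) p =
  ((size s)%:R^-1 * (2 / ((size s)%:R - 1)) ^+ 2
    * \sum_(x <- s) score s x ^+ 2)%:E.
Proof.
move=> us; have rs := perm_root_seq; have ur : uniq (root_seq p).
  by rewrite (perm_uniq rs).
rewrite /fisher_info ur -(perm_size rs); set r := root_seq p in rs ur *.
congr (_%:E); rewrite -mulrA; congr (_ * _).
rewrite -(perm_big _ rs) /= (big_nth 0) big_mkord mulr_sumr.
apply: eq_bigr => i _; rewrite exprMn; congr (_ * _ ^+ 2).
rewrite /score -(perm_big _ rs) /= [RHS](big_nth 0) big_mkord.
by apply: eq_bigl => j; rewrite nth_uniq.
Qed.

Lemma rescaleE (c : R) :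
  c != 0 ->
  rescale c p = k *: \prod_(y <- [seq c * x | x <- s]) ('X - y%:P).
Proof.
move=> c0; rewrite /rescale /degree size_scale_prod_XsubC /= /p comp_polyZ.
rewrite scalerA mulrC -scalerA big_map; congr (_ *: _).
(* The exponent of [c] is the number of factors, so each factor absorbs one [c]. *)
elim: s => [|x r IHr]; first by rewrite !big_nil comp_polyC expr0 scale1r.
rewrite !big_cons /= comp_polyM comp_polyB comp_polyX comp_polyC exprS.
have -> : 'X - (c * x)%:P = c *: (c^-1 *: 'X - x%:P).
  by rewrite scalerBr scalerA mulfV // scale1r -mul_polyC -polyCM.
by rewrite -IHr -scalerAl -scalerAr scalerA.
Qed.

End RootSeq.

(** * The variance normalisation and the final inequality *)

(** A zero variance would make the sum of the squares (x - mu)^2 vanish, forcing all entries to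
    equal the mean. This allows the variance to be cancelled when solving for [c ^+ 2]. *)
Lemma sample_variance_neq0 (F : realFieldType) (s : seq F) :
  uniq s -> (1 < size s)%N ->
  (size s)%:R^-1 * (\sum_(x <- s) x ^+ 2)
    - ((size s)%:R^-1 * \sum_(x <- s) x) ^+ 2 != 0.
Proof.
move=> us s1; have n0 : (size s)%:R != 0 :> F by rewrite pnatr_eq0 -lt0n ltnW.
set mu := _^-1 * \sum_(x <- s) x; apply/eqP => V0.
have : \sum_(x <- s) (x - mu) ^+ 2 = 0.
  transitivity (\sum_(x <- s) (x ^+ 2 - 2 * mu * x + mu ^+ 2)).
    by apply: eq_bigr => x _; ring.
  rewrite big_split sumrB -mulr_sumr big_const_seq count_predT iter_addr_0 /=.
  have -> : \sum_(x <- s) x = (size s)%:R * mu by rewrite mulVKf.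
  have -> : \sum_(x <- s) x ^+ 2 = (size s)%:R * mu ^+ 2.
    by move/eqP: V0; rewrite subr_eq0 => /eqP <-; rewrite mulVKf.
  by rewrite -mulr_natl; ring.
move=> /eqP; rewrite psumr_eq0 => [|x _]; last exact: sqr_ge0.
case: s us s1 {n0 V0} mu => [|x [|y s]] //=; rewrite inE negb_or.
move=> /andP[/andP[/negP xy _] _] _ mu.
rewrite !sqrf_eq0 !subr_eq0 => /and3P[/eqP xmu /eqP ymu _].
by apply: xy; rewrite xmu -ymu.
Qed.

Theorem theorem1p3 (R : realType) (n : nat) (p : {poly R}) (c : R)
  (hdeg : size p = n.+1) (hp : real_rooted p) (hc : c != 0)
  (hvar : variance (rescale c p^`()) = variance p) :
  (fisher_info n.-1 (rescale c p^`()) <= fisher_info n p)%E.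
Proof.
(* A repeated root of [p] makes the right-hand side [+oo]. *)
have [us|nus] := boolP (uniq (root_seq p)); last first.
  by rewrite [X in (_ <= X)%E]/fisher_info (negPf nus) leey.
(* For [n <= 1] the derivative is constant, possibly zero, and its root list is empty either way.
   The left-hand side is then an empty sum, and the right-hand side is nonnegative. *)
have [n1|n1] := leqP n 1.
  have [k qk] : exists k, rescale c p^`() = k%:P.
    suff /size1_polyC -> : (size (p^`()) <= 1)%N.
      by rewrite /rescale comp_polyC -mul_polyC -polyCM; eexists.
    by rewrite size_deriv hdeg; case: (n) n1 => [|[]].
  have qr : root_seq (rescale c p^`()) = [::].
    suff -> : rescale c p^`() = k *: \prod_(x <- [::]) ('X - x%:P).
      have [->|k0] := eqVneq k 0; last by apply/perm_nilP/perm_root_seq.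
      by rewrite scale0r /root_seq rootsR0.
    by rewrite big_nil -mul_polyC mulr1.
  have n0 : n.-1 = 0%N by case: (n) n1 => [|[]].
  rewrite /fisher_info us qr n0 /= big_ord0 mulr0 lee_fin.
  by rewrite mulr_ge0 ?invr_ge0 ?ler0n // sumr_ge0 // => i _; exact: sqr_ge0.
have p0 : p != 0 by rewrite -size_poly_eq0 hdeg.
have := root_seqE p0 hp; set s := root_seq p in us *; set l := lead_coef p => pE.
have l0 : l != 0 by rewrite lead_coef_eq0.
have sn : size s = n.
  by apply/eqP; rewrite -eqSS -hdeg pE size_scale_prod_XsubC.
set P := \prod_(x <- s) ('X - x%:P) in pE.
have [t [ts ut tr]] : exists t, [/\ size t = n.-1, uniq t & all (root P^`()) t].
  rewrite -sn; apply: derivative_roots => //.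
  by apply/allP => x xs; rewrite root_prod_XsubC.
set k := lead_coef P^`().
have PE : P^`() = k *: \prod_(x <- t) ('X - x%:P).
  apply: all_roots_prod_XsubC => //; last by rewrite uniq_rootsE.
  by rewrite size_deriv size_prod_XsubC sn ts prednK // ltnW.
have k0 : k != 0.
  rewrite lead_coef_eq0 -size_poly_eq0 size_deriv size_prod_XsubC sn.
  by rewrite -lt0n ltnW.
have lk0 : l * k != 0 by rewrite mulf_neq0.
have p'E : p^`() = (l * k) *: \prod_(x <- t) ('X - x%:P).
  by rewrite pE derivZ PE scalerA.
have qE := rescaleE t lk0 hc; rewrite -p'E in qE.
move: hvar; rewrite qE {1}pE !varianceE // size_map ts sn.
set ct := [seq c * x | x <- t] => hvar.
have uct : uniq ct by rewrite map_inj_uniq //; exact: mulfI.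
have sct : size ct = n.-1 by rewrite size_map.
rewrite pE -{1}sct -{1}sn !fisher_infoE // sct sn lee_fin.
case: n n1 {hdeg} sn ts sct hvar => [//|m] m1 sn ts sct hvar.
pose s' : m.+1.-tuple R := Tuple (introT eqP sn).
pose t' : m.-tuple R := Tuple (introT eqP ts).
have T_le := @sum_sqr_score_critical_points R m s' t' k us ut k0 PE.
have e1 := @sum_critical_points R m s' t' k us ut k0 PE.
have e2 := @sum_sqr_critical_points R m s' t' k us ut k0 PE.
rewrite /= in T_le e1 e2.
have := sample_variance_neq0 us; rewrite sn => /(_ m1) V0.
have ctE : \sum_(x <- ct) x = c * \sum_(x <- t) x by rewrite big_map mulr_sumr.
have ct2E : \sum_(x <- ct) x ^+ 2 = c ^+ 2 * \sum_(x <- t) x ^+ 2.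
  by rewrite big_map mulr_sumr; apply: eq_bigr => x _; rewrite exprMn.
have -> : \sum_(x <- ct) score ct x ^+ 2
    = c ^- 2 * \sum_(x <- t) score t x ^+ 2.
  rewrite big_map mulr_sumr; apply: eq_bigr => x _.
  by rewrite score_scale // exprMn exprVn.
rewrite ctE ct2E e1 e2 -[m.+1.-1]/m in hvar *.
rewrite -[m.+1%:R]natr1 in hvar T_le V0 *.
rewrite ltnS in m1; have M0 : m%:R != 0 :> R by rewrite pnatr_eq0 -lt0n.
have : 1 <= m%:R :> R by rewrite ler1n.
have M1 : m%:R + 1 != 0 :> R by rewrite natr1 pnatr_eq0.
have c2 : 0 < c ^+ 2 by rewrite exprn_even_gt0.
move: (m%:R) M0 M1 hvar T_le V0 => M M0 M1.
move: (\sum_(x <- s) score s x ^+ 2) (\sum_(x <- t) score t x ^+ 2) => S T.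
move: (\sum_(x <- s) x) (\sum_(x <- s) x ^+ 2) => A B hvar T_le V0 M_ge1.
(* Here [M] is n - 1, and [hvar] reads c^2 (M - 1) / M V = V with V <> 0. *)
have cM : c ^+ 2 * (M - 1) = M.
  apply/esym/(mulIf V0); rewrite -[X in M * X]hvar.
  by field; rewrite M0 M1.
(* As [c ^+ 2] and [M] are positive, so is [M - 1]; this excludes n = 2. *)
have M10 : 0 < M - 1 by rewrite -(pmulr_rgt0 _ c2) cM; lra.
have cE := canRL (mulfK (lt0r_neq0 M10)) cM.
(* Substituting c^2 = M / (M - 1) gives both sides the same nonnegative factor 4 / (M^2 (M - 1)),
   which leaves exactly [T_le]. *)
have -> : M^-1 * (2 / (M - 1)) ^+ 2 * (c ^- 2 * T)
    = 4 / (M ^+ 2 * (M - 1)) * T.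
  by rewrite cE; field; rewrite M0 gt_eqF.
have -> : (M + 1)^-1 * (2 / (M + 1 - 1)) ^+ 2 * S
    = 4 / (M ^+ 2 * (M - 1)) * ((1 - 2 / (M + 1)) * S).
  by rewrite addrK; field; rewrite M0 M1 gt_eqF.
apply: ler_wpM2l T_le; rewrite divr_ge0 ?ler0n //.
by rewrite mulr_ge0 ?sqr_ge0 // ltW.
Qed.
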